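(* Suppose $\mathbb{Z}^D=\Gamma_1\oplus\Gamma_2\oplus\cdots\oplus\Gamma_r\oplus\Lambda$ is a direct sum decomposition into subgroups, and for $i=1,\dots,r$ let $\mathbf X_i=(X_i,\Sigma_i,\mu_i,T_i)\in\mathsf Z_0^{\Gamma_i}$ be $\mathsf C_i$-sated, where \[\mathsf C_i:=\bigvee_{j\le r,\,j\ne i}\mathsf Z_0^{\Gamma_i+\Gamma_j}.\] Then for any joining $\pi_i:\mathbf Y=(Y,\Phi,\nu,S)\to\mathbf X_i$, $i=1,\dots,r$, the $\sigma$-algebras $\pi_i^{-1}(\Sigma_i)$ are relatively independent under $\nu$ over \[\pi_i^{-1}\Big(\bigvee_{j\le r,\,j\ne i}\Sigma_i^{T_i\upharpoonright(\Gamma_i+\Gamma_j)}\Big),\quad i=1,\dots,r.\]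
   Context: $\mathbb{Z}^D$-systems: standard Borel probability spaces with measure-preserving $\mathbb{Z}^D$-actions. For $\Lambda\le\mathbb{Z}^D$: $\Sigma^{T\upharpoonright\Lambda}=\{A:\mu(A\triangle T^\gamma A)=0\ \forall\gamma\in\Lambda\}$; $\mathsf Z_0^\Lambda$ is the class of systems with $T^\gamma=\mathrm{id}$ for $\gamma\in\Lambda$. A joining of $\mathbf X_1,\dots,\mathbf X_r$ is a system with factor maps onto each whose pulled-back $\sigma$-algebras generate everything; the join $\mathsf C_1\vee\cdots\vee\mathsf C_m$ of classes is the class of all joinings of members of the $\mathsf C_j$. Sub-$\sigma$-algebras $\Sigma'_i\supseteq\Xi_i$ are relatively independent over $(\Xi_i)$ under $\nu$ if $\int\prod_i f_i\,d\nu=\int\prod_i\mathsf E_\nu(f_i\mid\Xi_i)\,d\nu$ for all bounded $\Sigma'_i$-measurable $f_i$. For an idempotent class $\mathsf C$ (contains trivial system, closed under isomorphism, joinings, inverse limits), $\zeta^{\mathbf X}_{\mathsf C}$ coordinatizes the maximal factor in $\mathsf C$, and $\mathbf X$ is $\mathsf C$-sated if for every extension $\pi:\tilde{\mathbf X}\to\mathbf X$ and $f\in L^\infty(\mu)$, $\mathsf E(f\circ\pi\mid\zeta^{\tilde{\mathbf X}}_{\mathsf C})=\mathsf E(f\mid\zeta^{\mathbf X}_{\mathsf C})\circ\pi$. *)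

(* Defs.v *)
From HB Require Import structures.
From mathcomp Require Import all_boot all_order all_algebra.
From mathcomp Require Import all_classical all_reals all_analysis.
Set Implicit Arguments. Unset Strict Implicit. Unset Printing Implicit Defensive.
Import Order.TTheory GRing.Theory Num.Theory.
Local Open Scope classical_set_scope.
Local Open Scope ring_scope.

Definition is_subgroup (D : nat) (L : set 'rV[int]_D) : Prop :=
  L 0 /\ (forall x y, L x -> L y -> L (x - y)).

Definition sumset (D : nat) (A B : set 'rV[int]_D) : set 'rV[int]_D :=
  [set v | exists a b, A a /\ B b /\ v = a + b].

Definition direct_sum_decomp (D r : nat) (G : 'I_r -> set 'rV[int]_D)
    (L : set 'rV[int]_D) : Prop :=
  (forall i, is_subgroup (G i)) /\ is_subgroup L /\
  (forall v : 'rV[int]_D, exists (g : 'I_r -> 'rV[int]_D) (l : 'rV[int]_D),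
      (forall i, G i (g i)) /\ L l /\ v = \sum_i g i + l) /\
  (forall (g g' : 'I_r -> 'rV[int]_D) (l l' : 'rV[int]_D),
      (forall i, G i (g i)) -> L l -> (forall i, G i (g' i)) -> L l' ->
      \sum_i g i + l = \sum_i g' i + l' -> (forall i, g i = g' i) /\ l = l').

(* Standard Borel space: Borel-isomorphic to a Borel subset of the reals
   (Kuratowski). *)
Definition standard_borel (R : realType) (d : measure_display)
    (T : measurableType d) : Prop :=
  exists f : T -> R, injective f /\ measurable_fun setT f /\
    measurable (range f) /\ (forall A, measurable A -> measurable (f @` A)).

Record system (R : realType) (D : nat) := System {
  sys_disp : measure_display;
  sys_space : measurableType sys_disp;
  sys_mu : probability sys_space R;
  sys_act : 'rV[int]_D -> sys_space -> sys_space;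
  sys_std : standard_borel R sys_space;
  sys_act_meas : forall g, measurable_fun setT (sys_act g);
  sys_act_pres : forall g (A : set sys_space), measurable A ->
      sys_mu (sys_act g @^-1` A) = sys_mu A;
  sys_act0 : forall x, sys_act 0 x = x;
  sys_actD : forall g h x, sys_act (g + h) x = sys_act g (sys_act h x) }.

Arguments sys_space {R D} s.
Arguments sys_mu {R D} s.
Arguments sys_act {R D} s g x.

Definition symdiff (T : Type) (A B : set T) : set T := (A `\` B) `|` (B `\` A).

Definition factor_map (R : realType) (D : nat) (Y X : system R D)
    (p : sys_space Y -> sys_space X) : Prop :=
  measurable_fun setT p /\
  (forall A : set (sys_space X), measurable A ->
      sys_mu Y (p @^-1` A) = sys_mu X A) /\
  (forall g, {ae sys_mu Y, forall y, p (sys_act Y g y) = sys_act X g (p y)}).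

Definition pullback (T U : Type) (p : T -> U) (F : set (set U)) : set (set T) :=
  [set p @^-1` B | B in F].

Definition is_joining (R : realType) (D : nat) (I : finType) (P : pred I)
    (Y : system R D) (X : I -> system R D)
    (p : forall i, sys_space Y -> sys_space (X i)) : Prop :=
  (forall i, P i -> factor_map (p i)) /\
  (forall A : set (sys_space Y), measurable A ->
     exists B, <<s \bigcup_(i in [set i | P i]) pullback (p i) measurable >> B /\
       sys_mu Y (symdiff A B) = 0%E).

Arguments is_joining {R D I} P Y X p.
Arguments factor_map {R D Y X} p.

Definition sys_class (R : realType) (D : nat) := system R D -> Prop.

Definition Z0 (R : realType) (D : nat) (L : set 'rV[int]_D) : sys_class R D :=
  fun X => forall g, L g -> forall x, sys_act X g x = x.

Definition class_join (R : realType) (D : nat) (I : finType) (P : pred I)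
    (C : I -> sys_class R D) : sys_class R D :=
  fun Y => exists (X : I -> system R D) (p : forall i, sys_space Y -> sys_space (X i)),
    (forall i, P i -> C i (X i)) /\ is_joining P Y X p.

Definition max_factor_salg (R : realType) (D : nat) (C : sys_class R D)
    (X : system R D) : set (set (sys_space X)) :=
  <<s [set A | exists (Z : system R D) (p : sys_space X -> sys_space Z)
                 (B : set (sys_space Z)),
           C Z /\ factor_map p /\ measurable B /\ A = p @^-1` B] >>.

Arguments max_factor_salg {R D} C X.

Definition measurable_wrt (R : realType) (T : Type) (G : set (set T))
    (f : T -> R) : Prop :=
  forall B : set R, measurable B -> G (f @^-1` B).

Definition bounded_fun (R : realType) (T : Type) (f : T -> R) : Prop :=
  exists M : R, forall x, `|f x| <= M.

Definition is_cond_exp (R : realType) (d : measure_display) (T : measurableType d)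
    (mu : probability T R) (G : set (set T)) (f g : T -> R) : Prop :=
  measurable_wrt G g /\ mu.-integrable setT (EFin \o g) /\
  (forall A, G A -> (\int[mu]_(x in A) (g x)%:E = \int[mu]_(x in A) (f x)%:E)%E).

Definition sated (R : realType) (D : nat) (C : sys_class R D) (X : system R D) : Prop :=
  forall (Xt : system R D) (p : sys_space Xt -> sys_space X), factor_map p ->
  forall f : sys_space X -> R, measurable_fun setT f -> bounded_fun f ->
  forall (g : sys_space X -> R) (h : sys_space Xt -> R),
    is_cond_exp (sys_mu X) (max_factor_salg C X) f g ->
    is_cond_exp (sys_mu Xt) (max_factor_salg C Xt) (f \o p) h ->
    {ae sys_mu Xt, forall x, h x = g (p x)}.

Arguments sated {R D} C X.

(* Sigma^{T|L} = {A : mu(A symdiff T^g A) = 0 for all g in L};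
   T^g A is written as the preimage under T^(-g). *)
Definition inv_salg (R : realType) (D : nat) (X : system R D) (L : set 'rV[int]_D)
    : set (set (sys_space X)) :=
  [set A | measurable A /\
     forall g, L g -> sys_mu X (symdiff A (sys_act X (- g) @^-1` A)) = 0%E].

Arguments inv_salg {R D} X L.

Definition rel_indep (R : realType) (D : nat) (Y : system R D) (I : finType)
    (Sig Xi : I -> set (set (sys_space Y))) : Prop :=
  forall f g : I -> sys_space Y -> R,
    (forall i, measurable_wrt (Sig i) (f i) /\ bounded_fun (f i)) ->
    (forall i, is_cond_exp (sys_mu Y) (Xi i) (f i) (g i)) ->
    (\int[sys_mu Y]_y (\prod_i f i y)%:E = \int[sys_mu Y]_y (\prod_i g i y)%:E)%E.

Arguments rel_indep {R D} Y {I} Sig Xi.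
Arguments class_join {R D I} P C.
Arguments Z0 {R D} L.

(* Main.v *)
Require Import Defs.
From HB Require Import structures.
From mathcomp Require Import all_boot all_order all_algebra.
From mathcomp Require Import all_classical all_reals all_analysis.
From mathcomp Require Import measurable_realfun.
Set Implicit Arguments.
Unset Strict Implicit.
Unset Printing Implicit Defensive.
Import Order.TTheory GRing.Theory Num.Theory.
Import HBSimple HBNNSimple.
Local Open Scope classical_set_scope.
Local Open Scope ring_scope.

(** Fix [i] and let [q] be the projection of Z^D that kills [G i].  Because [X i]
    is [G i]-trivial, [p i] remains a factor map when the action of [Y] is
    precomposed with [q]; call the new system [Y'].  Every other [X k],
    re-parametrized in the same way, is trivial under [G i + G k], so functions
    lifted through [p k], [k != i], are measurable for the maximal [C_i]-factor of
    [Y'].  Satedness of [X i] along [Y' -> X i] then allows [f_i] to be replaced by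
    its conditional expectation in the integral of the product; doing this for one
    index after another gives relative independence.  Satedness speaks of the
    maximal [C_i]-factor of [X i], but only its inclusion in the sigma-algebra
    generated by the [Sigma_i^(G i + G j)] is needed. *)

(** * Integrals of bounded functions and conditional expectations *)

Lemma integrable_of_bounded (R : realType) (d : measure_display)
    (T : measurableType d) (mu : {finite_measure set T -> \bar R})
    (M : R) (f : T -> R) (A : set T) : measurable A ->
  measurable_fun setT f -> (forall x, `|f x| <= M) ->
  mu.-integrable A (EFin \o f).
Proof.
move=> mA mf fM; apply: (@integrableS _ _ _ _ setT) => //.
apply: measurable_bounded_integrable => //; first exact: fin_num_fun_lty.
exists M; split; first exact: num_real.
by move=> x Mx y _; apply: le_trans (fM y) (ltW Mx).
Qed.

(** Test the hypothesis on [A = {M < f}]: there [f - M] is positive, yet its integral is at most 0.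
    So [f = M] almost everywhere on [A], which makes [A] null. *)
Lemma ae_le_of_integral_le (R : realType) (d : measure_display)
    (T : measurableType d) (mu : {finite_measure set T -> \bar R})
    (M : R) (f : T -> R) :
  mu.-integrable setT (EFin \o f) ->
  (forall A, measurable A -> \int[mu]_(x in A) (f x)%:E <= M%:E * mu A)%E ->
  {ae mu, forall x, f x <= M}.
Proof.
move=> intf leA.
have mf : measurable_fun setT f by apply/measurable_EFinP; case/integrableP: intf.
pose A := [set x | M < f x].
have mA : measurable A.
  rewrite (_ : A = f @^-1` `]M, +oo[); last first.
    by apply/seteqP; split => x /=; rewrite in_itv/= andbT.
  by rewrite -[X in measurable X]setTI; exact: mf.
have iA : mu.-integrable A (EFin \o f) by apply: integrableS intf.
have iM : mu.-integrable A (EFin \o cst M).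
  by apply: (@integrable_of_bounded _ _ _ _ `|M|).
have mfM : measurable_fun A (fun x => (f x - M)%:E).
  apply/measurable_EFinP; apply: measurable_funB => //.
  exact: measurable_funTS.
have /(ae_eq_integral_abs _ mA mfM) : (\int[mu]_(x in A) `|(f x - M)%:E| = 0)%E.
  rewrite (eq_integral (fun x => (f x)%:E - M%:E)%E); last first.
    by move=> x; rewrite inE => Ax; rewrite gee0_abs// lee_fin subr_ge0 ltW.
  apply/eqP; rewrite eq_le; apply/andP; split; last first.
    by apply: integral_ge0 => x Ax; rewrite -EFinB lee_fin subr_ge0 ltW.
  rewrite integralB_EFin// integral_cst// sube_le0; exact: leA.
apply: filterS => x /= h; rewrite leNgt; apply/negP => Ax.
have [/eqP] := h Ax; by rewrite subr_eq0 => /eqP fxM; rewrite /A/= fxM ltxx in Ax.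
Qed.

Lemma ae_norm_le_of_integral_le (R : realType) (d : measure_display)
    (T : measurableType d) (mu : {finite_measure set T -> \bar R})
    (M : R) (f : T -> R) :
  mu.-integrable setT (EFin \o f) ->
  (forall A, measurable A -> `| \int[mu]_(x in A) (f x)%:E | <= M%:E * mu A)%E ->
  {ae mu, forall x, `|f x| <= M}.
Proof.
move=> intf leA.
have h1 : {ae mu, forall x, f x <= M}.
  apply: ae_le_of_integral_le => // A mA.
  by apply: le_trans (leA A mA); exact: lee_abs.
have h2 : {ae mu, forall x, - f x <= M}.
  apply: (@ae_le_of_integral_le _ _ _ _ _ (fun x => - f x)).
    exact: (integrableN intf).
  move=> A mA; apply: le_trans (leA A mA).
  have iA : mu.-integrable A (EFin \o f) by apply: integrableS intf.
  under eq_integral do rewrite EFinN.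
  rewrite integralN; last by apply: integrable_add_def.
  by rewrite -abseN; exact: lee_abs.
apply: filterS2 h1 h2 => x; rewrite ler_norml => -> /=.
by rewrite lerNl => ->.
Qed.

(** [F] is the Radon-Nikodym derivative, with respect to the law of [phi], of the charge sending [A]
    to the integral of [f] over the preimage of [A]; it is E(f | phi) seen as a function on [U]. An
    identity map into a coarser sigma-algebra yields conditional expectations on [T]; a factor map
    yields functions on the factor. *)
Lemma exists_pushforward_density (R : realType) (d d' : measure_display)
    (T : measurableType d) (U : measurableType d')
    (mu : probability T R) (phi : T -> U) (M : R) (f : T -> R) :
  measurable_fun setT phi -> measurable_fun setT f -> (forall x, `|f x| <= M) ->
  exists F : U -> R, [/\ measurable_fun setT F, (forall x, `|F x| <= M) &
    forall A, measurable A -> (\int[mu]_(x in phi @^-1` A) (F (phi x))%:E =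
      \int[mu]_(x in phi @^-1` A) (f x)%:E)%E].
Proof.
move=> mphi mf fM.
have intf : mu.-integrable setT (EFin \o f).
  exact: (@integrable_of_bounded _ _ _ _ M).
have M0 : 0 <= M by apply: le_trans (fM point).
have preimm A : measurable A -> measurable (phi @^-1` A).
  by move=> mA; rewrite -[X in measurable X]setTI; exact: mphi.
pose Phi : {mfun T >-> U} := mfun_Sub (mem_set mphi : phi \in mfun).
pose P := distribution mu Phi.
pose nu_ : {charge set U -> \bar R} := pushforward (induced_charge intf) phi.
pose nu := nu_ mphi.
have nuE A : nu A = (\int[mu]_(x in phi @^-1` A) (f x)%:E)%E by [].
have dom : nu `<< P.
  apply/null_content_dominatesP => A mA PA0; rewrite nuE.
  apply: null_set_integral => //; first exact: preimm.
  by apply/measurable_EFinP; exact: measurable_funTS.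
pose F0 : U -> \bar R := Radon_Nikodym nu P.
have F0fin x : F0 x \is a fin_num by exact: Radon_Nikodym_fin_num.
have F0int : P.-integrable setT F0 by exact: Radon_Nikodym_integrable.
have F0E A : measurable A -> (nu A = \int[P]_(x in A) F0 x)%E.
  exact: Radon_Nikodym_integral.
pose F1 x := fine (F0 x).
have F01 : F0 = EFin \o F1 by apply/funext => x; rewrite /F1/= fineK.
have mF1 : measurable_fun setT F1.
  by apply/measurable_EFinP; rewrite -F01; case/integrableP: F0int.
have F1M : {ae P, forall x, `|F1 x| <= M}.
  apply: ae_norm_le_of_integral_le; first by rewrite -F01.
  move=> A mA; rewrite (_ : (\int[P]_(x in A) (F1 x)%:E = nu A)%E); last first.
    by rewrite F0E// F01.
  rewrite nuE; apply: le_trans (le_abse_integral _ _ _) _ => //.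
  - exact: preimm.
  - by apply/measurable_EFinP; exact: measurable_funTS.
  rewrite [X in (_ <= _ * X)%E](_ : _ = mu (phi @^-1` A))// -integral_cst//; last exact: preimm.
  apply: ge0_le_integral => //; first exact: preimm.
    by apply: measurableT_comp => //; apply/measurable_EFinP; exact: measurable_funTS.
  by move=> x _; rewrite lee_fin.
(* The derivative is bounded by [M] only almost everywhere; truncation makes the bound hold
   everywhere without changing any integral. *)
pose F x : R := Num.max (- M) (Num.min M (F1 x)).
have mF : measurable_fun setT F.
  by apply: measurable_maxr => //; exact: measurable_minr.
have FM x : `|F x| <= M.
  by rewrite ler_norml /F le_max lexx/= ge_max ge_min lexx/= (le_trans _ M0)// oppr_le0.
exists F; split => // A mA.
have -> : (\int[mu]_(x in phi @^-1` A) (F (phi x))%:E = \int[P]_(x in A) (F x)%:E)%E.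
  rewrite /P /distribution integral_pushforward//; first exact/measurable_EFinP.
  apply: (@integrable_of_bounded _ _ _ _ M) => //; first exact: preimm.
  exact: measurableT_comp.
rewrite -nuE F0E//; apply: ae_eq_integral => //.
- by apply/measurable_EFinP; exact: measurable_funTS.
- by rewrite F01; apply/measurable_EFinP; exact: measurable_funTS.
apply: filterS F1M => x; rewrite ler_norml => /andP[h1 h2] _.
rewrite F01/= /F; congr EFin; rewrite min_r//; exact: max_r.
Qed.

Lemma measurable_wrtP (R : realType) (d : measure_display) (T : measurableType d)
    (G : set (set T)) (f : T -> R) : sigma_algebra setT G ->
  measurable_wrt G f <-> measurable_fun setT (f : g_sigma_algebraType G -> R).
Proof.
move=> sG; split => [mf _ B mB|mf B mB].
  by rewrite setTI; apply: sub_sigma_algebra; exact: mf.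
rewrite -(sigma_algebra_id sG) -[X in <<s _ >> X]setTI; exact: (mf measurableT).
Qed.

Lemma measurable_fun_sub_id (d : measure_display) (T : measurableType d)
    (G : set (set T)) : sigma_algebra setT G -> G `<=` measurable ->
  measurable_fun setT (id : T -> g_sigma_algebraType G).
Proof.
move=> sG Gm _ B; rewrite setTI preimage_id => mB; apply: Gm.
by rewrite -(sigma_algebra_id sG).
Qed.

(** The pushforward density for the identity from [T] to [T] equipped with [G]. The pointwise bound
    on [g] makes later products integrable. *)
Lemma exists_cond_exp (R : realType) (d : measure_display) (T : measurableType d)
    (mu : probability T R) (G : set (set T)) (M : R) (f : T -> R) :
  sigma_algebra setT G -> G `<=` measurable ->
  measurable_fun setT f -> (forall x, `|f x| <= M) ->
  exists g, is_cond_exp mu G f g /\ (forall x, `|g x| <= M).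
Proof.
move=> sG Gm mf fM.
have [F [mF FM FE]] := exists_pushforward_density mu
  (measurable_fun_sub_id sG Gm) mf fM.
have FG : measurable_wrt G F by exact/measurable_wrtP.
exists F; split => //; split => //; split.
  apply: (@integrable_of_bounded _ _ _ _ M) => //.
  by move=> _ B mB; rewrite setTI; apply: Gm; exact: FG.
by move=> A GA; apply: FE; exact: sub_sigma_algebra.
Qed.

(** On [T] equipped with [G] and the restricted measure, [u] and [v] have equal integrals over all
    measurable sets, hence agree almost everywhere. *)
Lemma cond_exp_ae_unique (R : realType) (d : measure_display) (T : measurableType d)
    (mu : probability T R) (G : set (set T)) (u v : T -> R) :
  sigma_algebra setT G -> G `<=` measurable ->
  measurable_wrt G u -> measurable_wrt G v ->
  mu.-integrable setT (EFin \o u) -> mu.-integrable setT (EFin \o v) ->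
  (forall A, G A -> \int[mu]_(x in A) (u x)%:E = \int[mu]_(x in A) (v x)%:E)%E ->
  {ae mu, forall x, u x = v x}.
Proof.
move=> sG Gm Gu Gv iu iv uv.
pose Phi : {mfun T >-> g_sigma_algebraType G} :=
  mfun_Sub (mem_set (measurable_fun_sub_id sG Gm)).
pose P := distribution mu Phi.
have mu' : measurable_fun setT (EFin \o (u : g_sigma_algebraType G -> R)).
  by apply/measurable_EFinP/measurable_wrtP.
have mv' : measurable_fun setT (EFin \o (v : g_sigma_algebraType G -> R)).
  by apply/measurable_EFinP/measurable_wrtP.
have : ae_eq P setT (EFin \o (u : g_sigma_algebraType G -> R)) (EFin \o v).
  apply: integral_ae_eq => //.
    rewrite /P /distribution; apply: integrable_pushforward => //.
  move=> E _ mE; have GE : G E by rewrite -(sigma_algebra_id sG).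
  have mE' := Gm _ GE.
  rewrite /P /distribution !integral_pushforward//; first exact: uv.
  - by apply: integrableS iv.
  - by apply: integrableS iu.
(* The exceptional set found there belongs to [G], so it is also a null set for [mu]. *)
case=> N [mN PN sN]; exists N; split => //.
  by apply: (Gm N); rewrite -(sigma_algebra_id sG).
by apply: subset_trans sN => x /= h h'; apply: h; case: (h' Logic.I).
Qed.

(** The claim holds for [G]-measurable simple functions by linearity, and passes to [H] by dominated
    convergence. *)
Lemma integral_mulr_eq0 (R : realType) (d : measure_display) (T : measurableType d)
    (mu : probability T R) (G : set (set T)) (K M : R) (w H : T -> R) :
  sigma_algebra setT G -> G `<=` measurable ->
  measurable_fun setT w -> (forall x, `|w x| <= K) ->
  measurable_wrt G H -> (forall x, `|H x| <= M) ->
  (forall A, G A -> \int[mu]_(x in A) (w x)%:E = 0)%E ->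
  (\int[mu]_x (w x * H x)%:E = 0)%E.
Proof.
move=> sG Gm mw wK GH HM w0.
have mGf (f : T -> R) : measurable_fun setT (f : g_sigma_algebraType G -> R) ->
    measurable_fun setT f.
  by move=> mf _ B mB; rewrite setTI; apply: Gm; exact: ((measurable_wrtP f sG).2 mf).
have K0 : 0 <= K by apply: le_trans (wK point).
have M0 : 0 <= M by apply: le_trans (HM point).
have mH : measurable_fun setT (H : g_sigma_algebraType G -> R) by exact/measurable_wrtP.
(* Shifting by [M] gives a nonnegative function, which increasing simple functions approximate from
   below. *)
pose H' : g_sigma_algebraType G -> R := fun x => H x + M.
have mH' : measurable_fun setT H' by exact: measurable_funD.
have H'0 x : 0 <= H' x by have := HM x; rewrite /H' ler_norml -subr_ge0 opprK => /andP[].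
have H'M x : H' x <= M + M.
  by rewrite /H' lerD2r; have := HM x; rewrite ler_norml => /andP[].
have mEH' : measurable_fun setT (EFin \o H') by exact/measurable_EFinP.
pose h n : g_sigma_algebraType G -> R := nnsfun_approx measurableT mEH' n.
have h0 n x : 0 <= h n x by [].
have hH' n x : h n x <= H' x.
  rewrite /h nnsfun_approxE -lee_fin; apply: (le_approx _ (f := EFin \o H')) => //.
  by move=> y _ /=; rewrite lee_fin.
have hcvg x : (EFin \o h ^~ x) @ \oo --> (H' x)%:E.
  have := @cvg_nnsfun_approx _ _ _ _ measurableT _ mEH' _ x Logic.I.
  by apply => y _ /=; rewrite lee_fin.
have mhG n : measurable_fun setT (h n) by exact: measurable_funP.
have mh n : measurable_fun setT (h n : T -> R) by exact: mGf.
have iw A : measurable A -> mu.-integrable A (EFin \o w).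
  by move=> mA; exact: (@integrable_of_bounded _ _ _ _ K).
have int0 n : (\int[mu]_x (w x * h n x)%:E = 0)%E.
  pose s := fset_set (range (nnsfun_approx measurableT mEH' n)).
  pose A y : set T := h n @^-1` [set y].
  have GA y : G (A y).
    by rewrite -(sigma_algebra_id sG) -[X in <<s _ >> X]setTI; exact: (mhG n measurableT).
  (* Split the simple function along its level sets [A y]; they lie in [G], so [w] integrates to 0
     over each. *)
  rewrite (eq_integral (fun x : T =>
     \sum_(y <- finmap.enum_fset s) (y%:E * ((EFin \o w) \_ (A y)) x))%E); last first.
    move=> x _; rewrite [h n x]fimfunE fsbig_finite//= mulr_sumr -sumEFin.
    apply: eq_bigr => y _; rewrite patchE indicE -/(A y).
    case: (x \in A y) => /=; first by rewrite mulr1 -EFinM mulrC.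
    by rewrite !mulr0 mule0.
  have iwA y : mu.-integrable setT ((EFin \o w) \_ (A y)).
    by rewrite -integrable_mkcond; [apply: iw|]; exact: Gm.
  rewrite integral_sum//=; last by move=> y; exact: integrableZl.
  rewrite big1// => y _; rewrite integralZl// -integral_mkcond.
  by rewrite (w0 _ (GA y)) mule0.
have mwH' : measurable_fun setT (fun x : T => w x * H' x).
  by apply: measurable_funM => //; exact: mGf.
(* The dominating constant comes from [|w| <= K] and [h n <= H' <= M + M]. *)
have [|||_ _] := @dominated_convergence _ _ _ mu setT measurableT
  (fun n x => (w x * h n x)%:E) (fun x => (w x * H' x)%:E)
  (cst (K * (M + M))%:E)
  (fun n => (measurable_EFinP _ _).2 (measurable_funM mw (mh n)))
  ((measurable_EFinP _ _).2 mwH').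
- apply: aeW => x _; under eq_fun do rewrite EFinM; rewrite EFinM.
  by apply: cvgeZl => //; exact: hcvg.
- by apply: (@integrable_of_bounded _ _ _ _ `|K * (M + M)|).
- apply: aeW => x n _; rewrite lee_fin normrM ler_pM// ger0_norm//.
  exact: le_trans (H'M x).
rewrite /=; under eq_fun do rewrite int0.
move=> lim.
have int1 : (\int[mu]_x (w x * H' x)%:E = 0)%E.
  by apply/esym; exact: (cvg_unique _ (cvg_cst _) lim).
(* Undo the shift: its contribution is [M] times the integral of [w] over the whole space, which is
   a set of [G]. *)
rewrite (eq_integral (fun x => (w x * H' x)%:E - M%:E * (w x)%:E)%E); last first.
  by move=> x _; rewrite -EFinM -EFinB /H' mulrDr [M * _]mulrC addrK.
rewrite integralB//.
- by rewrite int1 integralZl ?iw// w0 ?mule0 ?subee//; case: sG => G0 GC _; rewrite -setC0 -setTD; exact: GC.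
- apply: (@integrable_of_bounded _ _ _ _ (K * (M + M))) => // x.
  by rewrite normrM ler_pM// ger0_norm.
- by apply: integrableZl => //; exact: iw.
Qed.

(** The difference [u - v] has zero integral over every set of [G], hence is orthogonal to [H]. *)
Lemma integral_mulr_cond_exp (R : realType) (d : measure_display)
    (T : measurableType d) (mu : probability T R) (G : set (set T)) (K M : R)
    (u v H : T -> R) :
  sigma_algebra setT G -> G `<=` measurable ->
  measurable_fun setT u -> (forall x, `|u x| <= K) ->
  measurable_fun setT v -> (forall x, `|v x| <= K) ->
  measurable_wrt G H -> (forall x, `|H x| <= M) ->
  (forall A, G A -> \int[mu]_(x in A) (u x)%:E = \int[mu]_(x in A) (v x)%:E)%E ->
  (\int[mu]_x (u x * H x)%:E = \int[mu]_x (v x * H x)%:E)%E.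
Proof.
move=> sG Gm mu' uK mv vK GH HM uv.
have iu A : measurable A -> mu.-integrable A (EFin \o u).
  by move=> mA; exact: (@integrable_of_bounded _ _ _ _ K).
have iv A : measurable A -> mu.-integrable A (EFin \o v).
  by move=> mA; exact: (@integrable_of_bounded _ _ _ _ K).
have mH : measurable_fun setT H by move=> _ B mB; rewrite setTI; apply: Gm; exact: GH.
have iM (f : T -> R) : measurable_fun setT f -> (forall x, `|f x| <= K) ->
    mu.-integrable setT (EFin \o (fun x => f x * H x)).
  move=> mf fK; apply: (@integrable_of_bounded _ _ _ _ (K * M)) => //.
    exact: measurable_funM.
  by move=> x; rewrite normrM ler_pM.
have : (\int[mu]_x ((u x - v x) * H x)%:E = 0)%E.
  apply: (@integral_mulr_eq0 _ _ _ _ G (K + K) M) => //.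
  - exact: measurable_funB.
  - by move=> x; apply: le_trans (ler_normB _ _) _; exact: lerD.
  move=> A GA; have mA := Gm _ GA.
  under eq_integral do rewrite EFinB.
  rewrite integralB_EFin ?iu ?iv// uv// subee//.
  by apply: integrable_fin_num => //; exact: iv.
under eq_integral do rewrite mulrBl EFinB.
rewrite integralB_EFin//; [|exact: iM..].
move/eqP; rewrite sube_eq ?add0e; first by move/eqP.
- by apply: integrable_fin_num => //; exact: iM.
- by rewrite fin_num_adde_defl//; apply: integrable_fin_num => //; exact: iM.
Qed.

(** * Pulled-back sigma-algebras and transfer along measure-preserving maps *)

Lemma sigma_algebra_pullback (T U : Type) (p : T -> U) (F : set (set U)) :
  sigma_algebra setT F -> sigma_algebra setT (pullback p F).
Proof.
move=> sF; rewrite (_ : pullback p F = preimage_set_system setT p F).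
  exact: sigma_algebra_preimage.
by apply/seteqP; split => A [B FB <-]; exists B; rewrite ?setTI.
Qed.

Lemma pullback_sub_measurable (d d' : measure_display) (T : measurableType d)
    (U : measurableType d') (p : T -> U) (F : set (set U)) :
  measurable_fun setT p -> F `<=` measurable -> pullback p F `<=` measurable.
Proof.
move=> mp Fm _ [B FB <-]; rewrite -[X in measurable X]setTI.
by apply: mp => //; exact: Fm.
Qed.

Lemma measurable_wrt_fun (R : realType) (d : measure_display)
    (T : measurableType d) (G : set (set T)) (f : T -> R) :
  G `<=` measurable -> measurable_wrt G f -> measurable_fun setT f.
Proof. by move=> Gm Gf _ B mB; rewrite setTI; apply: Gm; exact: Gf. Qed.

Lemma sub_measurable_wrt (R : realType) (T : Type) (F G : set (set T))
    (f : T -> R) : F `<=` G -> measurable_wrt F f -> measurable_wrt G f.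
Proof. by move=> FG Ff B mB; apply: FG; exact: Ff. Qed.

Lemma ae_eq_integral_EFin (R : realType) (d : measure_display)
    (T : measurableType d) (mu : probability T R) (A : set T) (u v : T -> R) :
  measurable A -> measurable_fun setT u -> measurable_fun setT v ->
  {ae mu, forall x, u x = v x} ->
  (\int[mu]_(x in A) (u x)%:E = \int[mu]_(x in A) (v x)%:E)%E.
Proof.
move=> mA mu' mv uv; apply: ae_eq_integral => //.
- by apply/measurable_EFinP; exact: measurable_funTS.
- by apply/measurable_EFinP; exact: measurable_funTS.
- by apply: filterS uv => x /= ->.
Qed.

(** An almost-everywhere Doob-Dynkin factorization that keeps the bound: with [f'] the pushforward
    density of [f] along [p], both [f] and [f' \o p] are measurable for the pulled-back
    sigma-algebra and have equal integrals over its sets. *)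
Lemma ae_factor_pullback (R : realType) (d d' : measure_display)
    (T : measurableType d) (U : measurableType d') (mu : probability T R)
    (p : T -> U) (F : set (set U)) (M : R) (f : T -> R) :
  measurable_fun setT p -> sigma_algebra setT F -> F `<=` measurable ->
  measurable_wrt (pullback p F) f -> (forall x, `|f x| <= M) ->
  exists f' : U -> R, [/\ measurable_wrt F f', (forall x, `|f' x| <= M) &
    {ae mu, forall x, f x = f' (p x)}].
Proof.
move=> mp sF Fm Ff fM.
have pm := pullback_sub_measurable mp Fm.
have mf := measurable_wrt_fun pm Ff.
have mp' : measurable_fun setT (p : T -> g_sigma_algebraType F).
  move=> _ B mB; apply: mp => //; apply: Fm.
  by rewrite -(sigma_algebra_id sF).
have [f' [mf' f'M f'E]] := exists_pushforward_density mu mp' mf fM.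
have Ff' : measurable_wrt F f' by exact/measurable_wrtP.
have pf' : measurable_wrt (pullback p F) (f' \o p).
  by move=> B mB; exists (f' @^-1` B) => //; exact: Ff'.
exists f'; split => //.
apply: (cond_exp_ae_unique (sigma_algebra_pullback p sF) pm) => //.
- exact: (@integrable_of_bounded _ _ _ _ M).
- apply: (@integrable_of_bounded _ _ _ _ M (f' \o p)) => //.
    exact: measurable_wrt_fun pm pf'.
  by move=> x; exact: f'M.
- move=> _ [B FB <-]; apply/esym; apply: f'E; exact: sub_sigma_algebra.
Qed.

Lemma integral_preimage (R : realType) (d d' : measure_display)
    (T : measurableType d) (U : measurableType d') (mu : probability T R)
    (nu : probability U R) (p : T -> U) (M : R) (f : U -> R) (A : set U) :
  measurable_fun setT p ->
  (forall B, measurable B -> mu (p @^-1` B) = nu B) ->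
  measurable_fun setT f -> (forall x, `|f x| <= M) -> measurable A ->
  (\int[mu]_(x in p @^-1` A) (f (p x))%:E = \int[nu]_(x in A) (f x)%:E)%E.
Proof.
move=> mp pres mf fM mA.
have mpA : measurable (p @^-1` A) by rewrite -[X in measurable X]setTI; exact: mp.
rewrite -[LHS](@integral_pushforward _ _ _ _ _ _ mp mu A (EFin \o f))//.
- by apply: eq_measure_integral => B mB _; exact: pres.
- exact/measurable_EFinP.
- apply: (@integrable_of_bounded _ _ _ _ M (f \o p)) => //.
    exact: measurableT_comp.
  by move=> x; exact: fM.
Qed.

Lemma ae_preimage (R : realType) (d d' : measure_display)
    (T : measurableType d) (U : measurableType d') (mu : probability T R)
    (nu : probability U R) (p : T -> U) (Q : U -> Prop) :
  measurable_fun setT p ->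
  (forall B, measurable B -> mu (p @^-1` B) = nu B) ->
  {ae nu, forall x, Q x} -> {ae mu, forall x, Q (p x)}.
Proof.
move=> mp pres [N [mN N0 QN]]; exists (p @^-1` N); split.
- by rewrite -[X in measurable X]setTI; exact: mp.
- by rewrite pres.
- by move=> x /= Qx; exact: QN.
Qed.

(** * Factor maps, invariant sets and the maximal factor of a join of classes *)

Lemma factor_map_comp (R : realType) (D : nat) (X Y Z : system R D)
    (p : sys_space X -> sys_space Y) (q : sys_space Y -> sys_space Z) :
  factor_map p -> factor_map q -> factor_map (q \o p).
Proof.
move=> [mp [pp ep]] [mq [pq eq]]; split; first exact: measurableT_comp.
split=> [A mA|g].
  rewrite comp_preimage pp ?pq//.
  by rewrite -[X in measurable X]setTI; exact: mq.
have := ae_preimage mp pp (eq g).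
by apply: filterS2 (ep g) => x /= -> ->.
Qed.

Lemma measurable_symdiff (d : measure_display) (T : measurableType d)
    (A B : set T) :
  measurable A -> measurable B -> measurable (symdiff A B).
Proof. by move=> mA mB; apply: measurableU; exact: measurableD. Qed.

(** Equivariance of [p] and triviality of [Z] give [p (T^(-g) x) = p x] for almost every [x], so a
    pulled-back set differs from its translate only inside a null set. Closure of [L] under negation
    matters because translates are written with [- g]. *)
Lemma pullback_factor_inv_salg (R : realType) (D : nat) (X Z : system R D)
    (p : sys_space X -> sys_space Z) (L : set 'rV[int]_D) :
  (forall g, L g -> L (- g)) -> factor_map p -> Z0 L Z ->
  pullback p measurable `<=` inv_salg X L.
Proof.
move=> LN [mp [pp ep]] ZL _ [B mB <-].
have mA : measurable (p @^-1` B) by rewrite -[X in measurable X]setTI; exact: mp.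
split => // g Lg.
have mTA : measurable (sys_act X (- g) @^-1` (p @^-1` B)).
  rewrite -[X in measurable X]setTI; exact: sys_act_meas.
apply/negligibleP; first exact: measurable_symdiff.
apply: negligibleS (ep (- g)) => x /= h; rewrite ZL; last exact: LN.
by move=> pE; case: h => -[] /=; rewrite pE.
Qed.

Lemma null_inv_salg (R : realType) (D : nat) (X : system R D)
    (L : set 'rV[int]_D) (A : set (sys_space X)) :
  measurable A -> sys_mu X A = 0%E -> inv_salg X L A.
Proof.
move=> mA A0; split => // g _.
have mTA : measurable (sys_act X (- g) @^-1` A).
  rewrite -[X in measurable X]setTI; exact: sys_act_meas.
apply/negligibleP; first exact: measurable_symdiff.
apply: (@negligibleS _ _ _ _ (A `|` sys_act X (- g) @^-1` A)).
  by move=> x [[? _]|[? _]]; [left|right].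
apply: negligibleU; first exact/negligibleP.
by apply/negligibleP => //; rewrite -A0; exact: sys_act_pres.
Qed.

(** An index [j0] is required: factors are joined only up to null sets, and these
    null sets are absorbed by the invariant sigma-algebra of [j0]. *)
Lemma max_factor_class_join_sub (R : realType) (D : nat) (I : finType)
    (P : pred I) (L : I -> set 'rV[int]_D) (X : system R D) (j0 : I) :
  P j0 -> (forall j g, L j g -> L j (- g)) ->
  max_factor_salg (class_join P (fun j => Z0 (L j))) X `<=`
    <<s \bigcup_(j in [set j | P j]) inv_salg X (L j) >>.
Proof.
move=> Pj0 LN; set Xi := <<s _ >>.
have sXi : sigma_algebra setT Xi by exact: smallest_sigma_algebra.
apply: smallest_sub => // _ [Z [p [B [[Xs [ps [ZXs [fps gen]]]] [fp [mB ->]]]]]].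
have [mp [pp _]] := fp.
have [B' [genB' BB']] := gen _ mB.
have mB' : measurable B'.
  apply: smallest_sub genB'; first exact: sigma_algebra_measurable.
  move=> _ [j Pj [C mC <-]]; have [mpj _] := fps _ Pj.
  by rewrite -[X in measurable X]setTI; exact: mpj.
(* The sets whose preimage under [p] lies in [Xi] form a sigma-algebra, so generators suffice; a
   generator pulls back along the factor map [ps j \o p] to a system trivial under [L j]. *)
have XiB' : Xi (p @^-1` B').
  suff : <<s \bigcup_(i in [set i | P i]) pullback (ps i) measurable >> `<=`
      image_set_system setT p Xi.
    by move=> /(_ _ genB'); rewrite /image_set_system/= setTI.
  apply: smallest_sub; first exact: sigma_algebra_image.
  move=> _ [j Pj [C mC <-]]; rewrite /image_set_system/= setTI.
  apply: sub_sigma_algebra; exists j => //.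
  apply: (@pullback_factor_inv_salg _ _ _ (Xs j) (ps j \o p)).
  - exact: LN.
  - by apply: factor_map_comp => //; exact: fps.
  - exact: ZXs.
  - by exists C.
have Xi0 N : measurable N -> N `<=` symdiff B B' -> Xi (p @^-1` N).
  move=> mN NBB'; apply: sub_sigma_algebra; exists j0 => //.
  apply: null_inv_salg.
    by rewrite -[X in measurable X]setTI; exact: mp.
  rewrite pp//; apply: (subset_measure0 _ _ NBB') => //.
  exact: measurable_symdiff.
(* [B] arises from [B'] by removing one null set and adding another; the preimages of both are in
   [Xi]. *)
rewrite (_ : p @^-1` B = (p @^-1` B' `\` p @^-1` (B' `\` B)) `|` p @^-1` (B `\` B')).
  have XiI : @measurable _ (g_sigma_algebraType Xi) = Xi by exact: sigma_algebra_id.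
  rewrite -XiI; apply: measurableU; first apply: measurableD.
  - by rewrite XiI.
  - rewrite XiI; apply: Xi0; first exact: measurableD.
    by move=> x; right.
  - rewrite XiI; apply: Xi0; first exact: measurableD.
    by move=> x; left.
apply/seteqP; split => x /=; rewrite /setD/=.
  move=> Bx; case: (pselect (B' (p x))) => B'x; last by right.
  by left; split => // -[].
by move=> [[B'x /not_andP[//|/contrapT]]|[]].
Qed.

(** * Satedness under the integral sign *)

(** Against such an [H], only the conditional expectations of [f] and [g] on the maximal [C]-factor
    of [Y] count. By satedness these are lifted from the maximal [C]-factor of [X], where they
    coincide because its sigma-algebra lies inside [Xi]. *)
Lemma sated_integral_mulr (R : realType) (D : nat) (C : sys_class R D)
    (X Y : system R D) (p : sys_space Y -> sys_space X)
    (Xi : set (set (sys_space X))) (M N : R) (f g H : sys_space Y -> R) :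
  sated C X -> factor_map p ->
  sigma_algebra setT Xi -> Xi `<=` measurable -> max_factor_salg C X `<=` Xi ->
  measurable_wrt (pullback p measurable) f -> (forall y, `|f y| <= M) ->
  is_cond_exp (sys_mu Y) (pullback p Xi) f g -> (forall y, `|g y| <= M) ->
  measurable_wrt (max_factor_salg C Y) H -> (forall y, `|H y| <= N) ->
  (\int[sys_mu Y]_y (f y * H y)%:E = \int[sys_mu Y]_y (g y * H y)%:E)%E.
Proof.
move=> satX fp sXi Xim maxXi pf fM [pg [ig gE]] gM HY HN.
have [mp [pp _]] := fp.
have smax (Z : system R D) : sigma_algebra setT (max_factor_salg C Z).
  exact: smallest_sigma_algebra.
have maxm (Z : system R D) : max_factor_salg C Z `<=` measurable.
  apply: smallest_sub; first exact: sigma_algebra_measurable.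
  move=> _ [W [q [B [_ [[mq _] [mB ->]]]]]].
  by rewrite -[X in measurable X]setTI; exact: mq.
have mH := measurable_wrt_fun (@maxm Y) HY.
have mf := measurable_wrt_fun (pullback_sub_measurable mp (@subset_refl _ _)) pf.
have mg := measurable_wrt_fun (pullback_sub_measurable mp Xim) pg.
(* Satedness concerns functions on [X], so [f] and [g] are first descended along [p]. *)
have [f' [mf' f'M ff']] := ae_factor_pullback (sys_mu Y) mp
  (sigma_algebra_measurable _) (@subset_refl _ _) pf fM.
have [g' [mg' g'M gg']] := ae_factor_pullback (sys_mu Y) mp sXi Xim pg gM.
have {}mf' := measurable_wrt_fun (@subset_refl _ _) mf'.
have {}mg' := measurable_wrt_fun Xim mg'.
have mf'p : measurable_fun setT (f' \o p) by exact: measurableT_comp.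
have mg'p : measurable_fun setT (g' \o p) by exact: measurableT_comp.
have f'g' A : Xi A ->
    (\int[sys_mu X]_(x in A) (f' x)%:E = \int[sys_mu X]_(x in A) (g' x)%:E)%E.
  move=> XiA; have mA := Xim _ XiA.
  have mpA : measurable (p @^-1` A) by rewrite -[X in measurable X]setTI; exact: mp.
  rewrite -(integral_preimage mp pp mf' f'M mA) -(integral_preimage mp pp mg' g'M mA).
  rewrite -(ae_eq_integral_EFin mpA mf mf'p ff').
  rewrite -(ae_eq_integral_EFin mpA mg mg'p gg').
  by rewrite gE//; exists A.
(* [k] is a conditional expectation of both [f'] and [g'], so satedness identifies
   the conditional expectations of their lifts to [Y]. *)
have [k [kf' kM]] := exists_cond_exp (sys_mu X) (smax X) (@maxm X) mf' f'M.
have kg' : is_cond_exp (sys_mu X) (max_factor_salg C X) g' k.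
  have [mk [ik kE]] := kf'; split => //; split => // A maxA.
  by rewrite kE// f'g'//; exact: maxXi.
have [hf [hf' hfM]] := exists_cond_exp (sys_mu Y) (smax Y) (@maxm Y) mf'p
  (fun y => f'M (p y)).
have [hg [hg' hgM]] := exists_cond_exp (sys_mu Y) (smax Y) (@maxm Y) mg'p
  (fun y => g'M (p y)).
have hfk := satX _ _ fp _ mf' (ex_intro _ M f'M) _ _ kf' hf'.
have hgk := satX _ _ fp _ mg' (ex_intro _ M g'M) _ _ kg' hg'.
have [phf [_ hfE]] := hf'; have [phg [_ hgE]] := hg'.
have mhf := measurable_wrt_fun (@maxm Y) phf.
have mhg := measurable_wrt_fun (@maxm Y) phg.
have mulH (u v : sys_space Y -> R) : measurable_fun setT u ->
    measurable_fun setT v -> {ae sys_mu Y, forall y, u y = v y} ->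
    (\int[sys_mu Y]_y (u y * H y)%:E = \int[sys_mu Y]_y (v y * H y)%:E)%E.
  move=> mu mv uv; apply: ae_eq_integral_EFin => //; [exact: measurable_funM..|].
  by apply: filterS uv => y ->.
(* Pass from [f] and [g] to the lifts of [f'] and [g'], then to their conditional expectations [hf]
   and [hg], both almost everywhere equal to [k \o p]. *)
rewrite (mulH _ _ mf mf'p ff') (mulH _ _ mg mg'p gg').
rewrite -(integral_mulr_cond_exp (smax Y) (@maxm Y) mhf hfM mf'p
  (fun y => f'M (p y)) HY HN hfE).
rewrite -(integral_mulr_cond_exp (smax Y) (@maxm Y) mhg hgM mg'p
  (fun y => g'M (p y)) HY HN hgE).
by apply: mulH => //; apply: filterS2 hfk hgk => y -> ->.
Qed.

(** * Re-parametrized actions, members of joined classes and the projection along one summand *)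

(** Kept transparent, so that the new space and measure are convertible to the old ones and the same
    maps, functions and integrals serve for both systems. *)
Definition reparam (R : realType) (D : nat) (q : 'rV[int]_D -> 'rV[int]_D)
    (q0 : q 0 = 0) (qD : forall g h, q (g + h) = q g + q h)
    (X : system R D) : system R D.
Proof.
refine (@System R D _ (sys_space X) (sys_mu X) (fun g => sys_act X (q g))
  (sys_std X) (fun g => @sys_act_meas R D X (q g))
  (fun g => @sys_act_pres R D X (q g)) _ _).
- by move=> x; rewrite q0; exact: sys_act0.
- by move=> g h x; rewrite qD; exact: sys_actD.
Defined.

Lemma standard_borel_unit (R : realType) : standard_borel R unit.
Proof.
have im (A : set unit) : measurable ((fun=> 0 : R) @` A).
  have [->|/set0P[x Ax]] := eqVneq A set0; first by rewrite image_set0.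
  rewrite (_ : _ @` A = [set 0]); first exact: measurable_set1.
  by apply/seteqP; split => [_ [y _ <-]//|_ ->]; exists x.
exists (fun=> 0); split; first by move=> [] [].
by split; [exact: measurable_cst|split => // A _; exact: im].
Qed.

(** Fills the remaining indices when a single system is viewed as a joining. *)
Definition point_system (R : realType) (D : nat) : system R D.
Proof.
refine (@System R D _ unit (dirac tt) (fun _ x => x) (standard_borel_unit R) _ _ _ _) => //.
Defined.

Lemma factor_map_reparam (R : realType) (D : nat) (q : 'rV[int]_D -> 'rV[int]_D)
    (q0 : q 0 = 0) (qD : forall g h, q (g + h) = q g + q h) (Y X : system R D)
    (p : sys_space Y -> sys_space X) :
  factor_map p ->
  @factor_map R D (reparam q0 qD Y) (reparam q0 qD X) p.
Proof. by move=> [mp [pp ep]]; split => //; split => // g; exact: (ep (q g)). Qed.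

(** Only the source changes its action here. This provides the extension of [X i] to which satedness
    is applied. *)
Lemma factor_map_reparam_l (R : realType) (D : nat) (q : 'rV[int]_D -> 'rV[int]_D)
    (q0 : q 0 = 0) (qD : forall g h, q (g + h) = q g + q h) (Y X : system R D)
    (p : sys_space Y -> sys_space X) :
  (forall g x, sys_act X (q g) x = sys_act X g x) -> factor_map p ->
  @factor_map R D (reparam q0 qD Y) X p.
Proof.
move=> qX [mp [pp ep]]; split => //; split => // g.
by apply: filterS (ep (q g)) => y /= ->.
Qed.

(** [Z] is the joining of itself, at index [i], with one-point systems at all other indices. *)
Lemma class_join_of_member (R : realType) (D : nat) (I : finType) (P : pred I)
    (C : I -> sys_class R D) (i : I) (Z : system R D) :
  P i -> C i Z -> (forall j, C j (point_system R D)) -> class_join P C Z.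
Proof.
move=> Pi CZ Cpt.
(* Indexing by the truth value of [j == i] lets the maps [w] be defined by cases, with no transport
   along an equality of indices. *)
pose W (b : bool) := if b then Z else point_system R D.
pose w (b : bool) : sys_space Z -> sys_space (W b) :=
  match b with true => id | false => fun=> tt end.
have fw b : factor_map (w b).
  case: b; split.
  - exact: measurable_id.
  - by split => // g; apply: aeW => x.
  - exact: measurable_cst.
  - split => [A mA|g]; last by apply: aeW => x.
    rewrite /= diracE; case: (boolP (tt \in A)) => [/set_mem Att|/negP nAtt].
      by rewrite (_ : _ @^-1` _ = setT) ?probability_setT//; apply/seteqP; split.
    rewrite (_ : _ @^-1` _ = set0) ?measure0//; apply/seteqP; split => // x /= Att.
    by case: nAtt; exact/mem_set.
exists (fun j => W (j == i)), (fun j => w (j == i)); split.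
  by move=> j Pj; rewrite /W; case: eqP => [->|].
split => [j _|A mA]; first exact: fw.
exists A; split; last first.
  by rewrite /symdiff setDv setUid measure0.
apply: sub_sigma_algebra; exists i => //.
have : (i == i) by [].
by case: (i == i) => // _; exists A.
Qed.

(** [q] subtracts from [v] its component in [G i]; uniqueness of the decomposition makes this
    component additive. *)
Lemma direct_sum_projection (D r : nat) (G : 'I_r -> set 'rV[int]_D)
    (L : set 'rV[int]_D) (i : 'I_r) : direct_sum_decomp G L ->
  exists q : 'rV[int]_D -> 'rV[int]_D, [/\ q 0 = 0,
    (forall g h, q (g + h) = q g + q h),
    (forall a, G i a -> q a = 0),
    (forall k a, k != i -> G k a -> q a = a) &
    (forall v, G i (v - q v))].
Proof.
move=> [sG [sL [ex uniq]]].
have subD A x y : is_subgroup A -> A x -> A y -> A (x + y).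
  move=> [A0 AB] Ax Ay; rewrite -[y]opprK; apply: (AB) => //.
  by rewrite -sub0r; exact: AB.
have /choice[c cP] : forall v, exists c : ('I_r -> 'rV[int]_D) * 'rV[int]_D,
    (forall i, G i (c.1 i)) /\ L c.2 /\ v = \sum_i c.1 i + c.2.
  by move=> v; have [g [l gl]] := ex v; exists (g, l).
(* The components [c] are merely chosen, but by uniqueness any decomposition of [v] computes the one
   at [i]. *)
have cE v g l : (forall i, G i (g i)) -> L l -> v = \sum_i g i + l ->
    (c v).1 i = g i.
  move=> Gg Ll vE; have [Gc [Lc vc]] := cP v.
  by have [-> _] := uniq _ _ _ _ Gc Lc Gg Ll (etrans (esym vc) vE).
have c1 k a : G k a -> (c a).1 i = if i == k then a else 0.
  move=> Ga; rewrite (cE _ (fun j => if j == k then a else 0) 0)//.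
  - by move=> j; case: eqP => [->//|_]; case: (sG j).
  - by case: sL.
  - by rewrite addr0 -big_mkcond big_pred1_eq.
have G0 : G i 0 by case: (sG i).
exists (fun v => v - (c v).1 i); split.
- by rewrite (c1 i)// eqxx subr0.
- move=> g h; have [Gg [Lg gE]] := cP g; have [Gh [Lh hE]] := cP h.
  rewrite (cE _ (fun j => (c g).1 j + (c h).1 j) ((c g).2 + (c h).2)).
  + by rewrite opprD addrACA.
  + by move=> j; apply: subD.
  + exact: subD.
  + by rewrite big_split/= {1}gE {1}hE addrACA.
- by move=> a Ga; rewrite (c1 i)// eqxx subrr.
- by move=> k a ki Ga; rewrite (c1 k)// eq_sym (negbTE ki) subr0.
- by move=> v; rewrite opprB addrC subrK; case: (cP v).
Qed.

Lemma measurable_wrt_prod (R : realType) (d : measure_display)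
    (T : measurableType d) (G : set (set T)) (I : finType) (P : pred I)
    (h : I -> T -> R) : sigma_algebra setT G ->
  (forall i, P i -> measurable_wrt G (h i)) ->
  measurable_wrt G (fun x => \prod_(i | P i) h i x).
Proof.
move=> sG mh; apply/measurable_wrtP => //.
rewrite (_ : (fun x => _) = fun x => \prod_i (if P i then h i x else 1)).
  apply: measurable_prod => i _; case: (boolP (P i)) => [Pi|_]; last exact: measurable_cst.
  by apply/measurable_wrtP => //; exact: mh.
by apply/funext => x; rewrite big_mkcond.
Qed.

(** * Replacing the functions one index at a time *)

(** A single replacement, at index [i]. The [h k] are arbitrary bounded functions lifted through
    [p k], so that they may be original functions or ones already replaced. *)
Lemma joining_integral_mulr (R : realType) (D r : nat) (G : 'I_r -> set 'rV[int]_D)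
    (L : set 'rV[int]_D) (X : 'I_r -> system R D) (Y : system R D)
    (p : forall i, sys_space Y -> sys_space (X i)) (i : 'I_r)
    (Xi := <<s \bigcup_(j in [set j : 'I_r | j != i])
               inv_salg (X i) (sumset (G i) (G j)) >>)
    (M : R) (N : 'I_r -> R)
    (f g : sys_space Y -> R) (h : 'I_r -> sys_space Y -> R) :
  direct_sum_decomp G L -> (forall j, Z0 (G j) (X j)) ->
  sated (class_join (fun j : 'I_r => j != i)
           (fun j => Z0 (sumset (G i) (G j)))) (X i) ->
  (forall j, factor_map (p j)) ->
  measurable_wrt (pullback (p i) measurable) f -> (forall y, `|f y| <= M) ->
  is_cond_exp (sys_mu Y) (pullback (p i) Xi) f g -> (forall y, `|g y| <= M) ->
  (forall k, measurable_wrt (pullback (p k) measurable) (h k)) ->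
  (forall k y, `|h k y| <= N k) ->
  (\int[sys_mu Y]_y (f y * \prod_(k | k != i) h k y)%:E =
   \int[sys_mu Y]_y (g y * \prod_(k | k != i) h k y)%:E)%E.
Proof.
move=> dec ZX satX fp pf fM gE gM mh hN.
have sXi : sigma_algebra setT Xi by exact: smallest_sigma_algebra.
(* If [i] is the only index, the product is 1 and the claim is the defining equality of the
   conditional expectation on the whole space. Otherwise [j0] supplies the index that absorbs null
   sets. *)
have [[j0 j0i]|none] := pselect (exists j0 : 'I_r, j0 != i); last first.
  have np k : (k != i) = false by apply/negbTE/negP => ki; apply: none; exists k.
  under eq_integral do rewrite big_pred0// mulr1.
  under [RHS]eq_integral do rewrite big_pred0// mulr1.
  have [_ [_ gA]] := gE; apply/esym/gA; exists setT => //.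
  by case: sXi => Xi0 XiC _; rewrite -setC0 -setTD; exact: XiC.
have [q [q0 qD qi qk qv]] := direct_sum_projection i dec.
pose C : sys_class R D := class_join (fun j : 'I_r => j != i) (fun j => Z0 (sumset (G i) (G j))).
have [sG _] := dec.
(* [v] and [q v] differ by an element of [G i], which acts trivially on [X i]. *)
have qX v x : sys_act (X i) (q v) x = sys_act (X i) v x.
  rewrite -[in RHS](subrK (q v) v) addrC sys_actD.
  by congr (sys_act _ _ _); rewrite (ZX i).
pose Y' := reparam q0 qD Y.
refine (@sated_integral_mulr R D C (X i) Y' (p i) Xi M (\prod_(k | k != i) N k)
  f g (fun y => \prod_(k | k != i) h k y) satX _ sXi _ _ pf fM gE gM _ _).
- exact: factor_map_reparam_l.
- apply: smallest_sub; first exact: sigma_algebra_measurable.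
  by move=> A [j _ []].
- apply: (@max_factor_class_join_sub R D _ (fun j => j != i)
    (fun j => sumset (G i) (G j)) (X i) j0 j0i) => j v [a [b [Ga [Gb ->]]]].
  have [G0 GB] := sG i; have [G0' GB'] := sG j.
  exists (0 - a), (0 - b); split; first exact: GB.
  by split; [exact: GB'|rewrite !sub0r opprD].
- apply: measurable_wrt_prod; first exact: smallest_sigma_algebra.
  (* Through [p k], the re-parametrized [X k] is a factor of [Y']. It is trivial under [G i + G k]:
     for [a] in [G i] and [b] in [G k], [q (a + b) = b], and [b] fixes every point of [X k]. *)
  move=> k ki; apply: sub_measurable_wrt (mh k) => _ [B mB <-].
  apply: sub_sigma_algebra; exists (reparam q0 qD (X k)), (p k), B; split.
    apply: (class_join_of_member (i := k)) => // v [a [b [Ga [Gb ->]]]] x /=.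
    by rewrite qD (qi a)// (qk k b)// add0r; exact: (ZX k).
  by split; [exact: factor_map_reparam|].
- by move=> y; rewrite normr_prod; apply: ler_prod => k _; rewrite normr_ge0 hN.
Qed.

Unset Implicit Arguments.

Theorem theorem4 (R : realType) (D r : nat) (G : 'I_r -> set 'rV[int]_D)
    (L : set 'rV[int]_D) (X : 'I_r -> system R D) :
  direct_sum_decomp G L ->
  (forall i, Z0 (G i) (X i)) ->
  (forall i, sated (class_join (fun j : 'I_r => j != i)
                      (fun j => Z0 (sumset (G i) (G j)))) (X i)) ->
  forall (Y : system R D) (p : forall i, sys_space Y -> sys_space (X i)),
    is_joining predT Y X p ->
    rel_indep Y (fun i => pullback (p i) measurable)
      (fun i => pullback (p i)
         <<s \bigcup_(j in [set j : 'I_r | j != i])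
               inv_salg (X i) (sumset (G i) (G j)) >>).
Proof.
move=> dec ZX satX Y p [fp_ _] f g fB gE.
have fp i : factor_map (p i) by exact: fp_.
pose Xi i := <<s \bigcup_(j in [set j : 'I_r | j != i])
               inv_salg (X i) (sumset (G i) (G j)) >>.
have pm i : pullback (p i) measurable `<=` measurable.
  by apply: pullback_sub_measurable => //; case: (fp i).
have sXi i : sigma_algebra setT (pullback (p i) (Xi i)).
  by apply: sigma_algebra_pullback; exact: smallest_sigma_algebra.
have Xip i : pullback (p i) (Xi i) `<=` pullback (p i) measurable.
  move=> _ [B XiB <-]; exists B => //; apply: smallest_sub XiB.
    exact: sigma_algebra_measurable.
  by move=> A [j _ []].
have Xim i := subset_trans (Xip i) (pm i).
have pf i : measurable_wrt (pullback (p i) measurable) (f i) by case: (fB i).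
have /choice[M fM] : forall i, exists M : R, forall y, `|f i y| <= M.
  by move=> i; case: (fB i).
(* The given [g i] are only integrable; bounded versions [g' i] are needed for the products, and
   almost everywhere uniqueness lets them stand in for [g i]. *)
have /choice[g' g'P] : forall i, exists g', is_cond_exp (sys_mu Y)
    (pullback (p i) (Xi i)) (f i) g' /\ (forall y, `|g' y| <= M i).
  move=> i; apply: exists_cond_exp => //.
  exact: measurable_wrt_fun (pm i) (pf i).
have pg' i : measurable_wrt (pullback (p i) measurable) (g' i).
  by apply: sub_measurable_wrt (Xip i) _; case: (g'P i) => -[].
have gg' : {ae sys_mu Y, forall y i, g i y = g' i y}.
  apply: filter_forall => i.
  have [pgi [igi giE]] := gE i; have [[pg'i [ig'i g'iE]] _] := g'P i.
  apply: (cond_exp_ae_unique (sXi i) (Xim i)) => // A XiA.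
  by rewrite giE// g'iE.
have mprod (h : 'I_r -> sys_space Y -> R) : (forall i, measurable_fun setT (h i)) ->
    measurable_fun setT (fun y => \prod_i h i y).
  by move=> mh; exact: measurable_prod.
rewrite [RHS](@ae_eq_integral_EFin _ _ _ _ _ _ (fun y => \prod_i g' i y))//;
  last 3 first.
- by apply: mprod => i; apply: (measurable_wrt_fun (Xim i)); case: (gE i).
- by apply: mprod => i; exact: measurable_wrt_fun (pm i) (pg' i).
- by apply: filterS gg' => y gy; apply: eq_bigr => i _.
(* Hybrid families: the functions at indices below [n] are already replaced. Induction on [n] runs
   from all [f i] at 0 to all [g' i] at [r]. *)
pose h n (i : 'I_r) := if (i < n)%N then g' i else f i.
suff hE n : (n <= r)%N -> (\int[sys_mu Y]_y (\prod_i f i y)%:E =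
    \int[sys_mu Y]_y (\prod_i h n i y)%:E)%E.
  rewrite (hE r)//; apply: eq_integral => y _; congr EFin.
  by apply: eq_bigr => i _; rewrite /h ltn_ord.
elim: n => [_|n IH nr].
  by apply: eq_integral => y _; congr EFin; apply: eq_bigr.
rewrite IH; last exact: ltnW.
pose i := Ordinal nr.
have hn y : \prod_i h n i y = f i y * \prod_(k | k != i) h n k y.
  by rewrite (bigD1 i)//= {1}/h/= ltnn.
(* [h n] and [h n.+1] differ only at the index [i] of value [n], so the same product over [k != i]
   occurs in both. *)
have hSn y : \prod_i h n.+1 i y = g' i y * \prod_(k | k != i) h n k y.
  rewrite (bigD1 i)//= {1}/h/= leqnn; congr (_ * _).
  apply: eq_bigr => k ki; rewrite /h ltnS leq_eqVlt.
  by rewrite -[n]/(val i) (inj_eq val_inj) (negbTE ki).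
under eq_integral do rewrite hn.
under [RHS]eq_integral do rewrite hSn.
have [g'i g'iM] := g'P i.
apply: (joining_integral_mulr dec ZX (satX i) fp (pf i) (fM i) g'i g'iM) => k.
- by rewrite /h; case: ifP.
- by move=> y; rewrite /h; case: ifP => _; [case: (g'P k)|].
Qed.
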